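(* Let $l\ge1$ be an integer, let $p_1,\dots,p_l\ge 1$ be integers, and fix $0<c<1$. Let $m=cn$ and let $\pi$ be chosen uniformly at random from $\mathrm{PF}(m,n)$. Then, as $n\to\infty$, $$\mathbb E\left(\prod_{i=1}^l\pi_i^{p_i}\right)=\frac{n^{\sum_{i=1}^lp_i}}{\prod_{i=1}^l(p_i+1)}\left(1+\frac1n\left(\frac{\sum_{i=1}^lp_i+l}{2}-\frac{c\sum_{i=1}^lp_i}{1-c}\right)+O\left(\frac1{n^2}\right)\right).$$
   Context: Write $[n]=\{1,\dots,n\}$. For integers $0\le m\le n$, $\mathrm{PF}(m,n)$ denotes the set of parking functions with $m$ cars and $n$ spots: sequences $(\pi_1,\dots,\pi_m)\in[n]^m$ such that, when cars $1,\dots,m$ enter in order a one-way street with spots $1,\dots,n$ and car $i$ parks in spot $\pi_i$ if it is free and otherwise in the first free spot after $\pi_i$, all cars park. Equivalently, the non-decreasing rearrangement $(\lambda_1,\dots,\lambda_m)$ satisfies $\lambda_i\le n-m+i$ for all $i$. The limit $n\to\infty$ is along integers $n$ with $cn$ an integer; $c,l,p_1,\dots,p_l$ are fixed and the $O$-constant may depend on them. *)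

(* Defs.v *)
From mathcomp Require Import all_boot all_order all_algebra.
From mathcomp Require Import reals.

Set Implicit Arguments.
Unset Strict Implicit.
Unset Printing Implicit Defensive.

Import Order.TTheory GRing.Theory Num.Theory.

(* Spot number j.+1 of the street (with j < n) is encoded by j : 'I_n. *)

(* [enum 'I_n] lists the spots in increasing order. *)
Definition first_free n (occupied : {set 'I_n}) (j : 'I_n) : option 'I_n :=
  ohead [seq k : 'I_n <- enum 'I_n | (j <= k)%N & k \notin occupied].

Fixpoint all_park n (occupied : {set 'I_n}) (prefs : seq 'I_n) : bool :=
  if prefs is j :: prefs' then
    if first_free occupied j is Some k then all_park (k |: occupied) prefs'
    else false
  else true.

Definition PF (m n : nat) : {set m.-tuple 'I_n} :=
  [set pi : m.-tuple 'I_n | all_park set0 pi].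

(* Preferred spot, numbered from 1, of the car of index i, numbered from 0.
   The default value 0 is only returned when i >= m. *)
Definition pref m n (pi : m.-tuple 'I_n) (i : nat) : nat :=
  nth 0 [seq (val j).+1 | j <- pi] i.

Local Open Scope ring_scope.

(* Expectation of X under the uniform distribution on A. *)
Definition unif_expect (R : realType) (T : finType) (A : {set T})
  (X : T -> R) : R := (\sum_(x in A) X x) / #|A|%:R.

(* Main.v *)
(* Cars park iff, for every y, at most n - y of them prefer a spot >= y (spots
   are numbered from 0), so the l marked cars may be added last.  Let sigma be
   the preferences of the other m - l cars.  A marked preference x is bad for
   sigma if sigma parks but sigma with x does not; the number of such sigma is
   [spill n (m - l) x].  Counting parking functions exactly, via
   (n + 1) #PF(m, n) = (n + 1 - m) (n + 1)^m, gives the total of [spill] over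
   x exactly.  A Chernoff bound shows that [spill] decays geometrically away
   from the end of the street, so its mass sits at x ~ n, and two marked cars
   are simultaneously bad with probability O(1/n^2).  The remaining correction
   to inclusion-exclusion ([overlap]) is bounded below by these pair events,
   and its sum is known exactly, hence its l1-norm is O(1/n^2) as well.
   The moments then follow from the two-term expansion of the power sums. *)
Require Import Defs.
From mathcomp Require Import all_boot all_order all_algebra.
From mathcomp Require Import reals sequences exp.
From mathcomp Require Import zify ring lra.

Set Implicit Arguments.
Unset Strict Implicit.
Unset Printing Implicit Defensive.

Import Order.TTheory GRing.Theory Num.Theory.
Local Open Scope ring_scope.

(** * Parking functions characterised by the loads of final segments of the street *)

Definition parkable (n : nat) (s : seq nat) : bool :=
  all (fun y => count (leq y) s <= n - y)%N (iota 0 n.+1).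

Lemma parkableP n s :
  reflect (forall y, y <= n -> count (leq y) s <= n - y)%N (parkable n s).
Proof.
apply: (iffP allP) => [h y yn|h y]; last by rewrite mem_iota ltnS; apply: h.
by apply: h; rewrite mem_iota ltnS.
Qed.

Lemma first_freeP n (occ : {set 'I_n}) (j : 'I_n) :
  match first_free occ j with
  | Some k => [/\ (j <= k)%N, k \notin occ &
                 forall i : 'I_n, (j <= i < k)%N -> i \in occ]
  | None => forall i : 'I_n, (j <= i)%N -> i \in occ
  end.
Proof.
rewrite /first_free.
set P := fun k : 'I_n => _ && _.
case E: [seq k <- enum 'I_n | P k] => [|k s] /=.
  move=> i ji; apply: contraT => ni.
  have : i \in [seq k <- enum 'I_n | P k] by rewrite mem_filter mem_enum /P ji ni.
  by rewrite E.
have : k \in [seq k <- enum 'I_n | P k] by rewrite E mem_head.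
rewrite mem_filter => /andP[/andP[jk nk] _]; split=> // i /andP[ji ik].
apply: contraT => ni.
have iin : i \in [seq k <- enum 'I_n | P k] by rewrite mem_filter mem_enum /P ji ni.
(* The filtered enumeration is increasing, so its head is the least admissible spot. *)
have srt : sorted ltn [seq val k | k <- [seq k <- enum 'I_n | P k]].
  apply: (subseq_sorted ltn_trans (map_subseq _ (filter_subseq _ _))).
  by rewrite val_enum_ord iota_ltn_sorted.
move: srt iin; rewrite E /= (path_sortedE ltn_trans) => /andP[/allP h _].
rewrite inE => /orP[/eqP e|si]; first by rewrite e ltnn in ik.
have hk : (k < i)%N by apply: h; apply: (map_f val si).
by lia.
Qed.

Definition occ_ge n (occ : {set 'I_n}) (y : nat) : nat :=
  #|[set k in occ | (y <= k)%N]|.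

Lemma occ_ge_setT n y : occ_ge [set: 'I_n] y = (n - y)%N.
Proof.
have [yn|ny] := leqP y n; last first.
  rewrite /occ_ge (_ : [set _ in _ | _] = set0) ?cards0; first by lia.
  by apply/setP => k; rewrite !inE; have := ltn_ord k; lia.
rewrite -[RHS]card_ord /occ_ge.
pose f (i : 'I_(n - y)) : 'I_n := cast_ord (subnKC yn) (rshift y i).
have fI : injective f by move=> i i' /cast_ord_inj /rshift_inj.
rewrite -(card_imset _ fI); apply: eq_card => k; rewrite !inE /=.
apply/idP/imsetP => [yk|[i _ ->]]; last exact: leq_addr.
have ky : (k - y < n - y)%N by have := ltn_ord k; lia.
by exists (Ordinal ky) => //; apply: val_inj; rewrite /= subnKC.
Qed.

Lemma occ_ge_le n (occ : {set 'I_n}) y : (occ_ge occ y <= n - y)%N.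
Proof.
rewrite -occ_ge_setT; apply/subset_leq_card/subsetP => k.
by rewrite !inE => /andP[_ ->].
Qed.

Lemma occ_ge_full n (occ : {set 'I_n}) y :
  (forall i : 'I_n, (y <= i)%N -> i \in occ) -> occ_ge occ y = (n - y)%N.
Proof.
move=> h; rewrite -occ_ge_setT; apply: eq_card => k; rewrite !inE.
by case: leqP => [/h ->|]; rewrite ?andbF.
Qed.

Lemma occ_geU1 n (occ : {set 'I_n}) k y : k \notin occ ->
  occ_ge (k |: occ) y = ((y <= k) + occ_ge occ y)%N.
Proof.
move=> nk; rewrite /occ_ge; case: leqP => yk.
  rewrite (_ : [set _ in k |: _ | _] = k |: [set i in occ | (y <= i)%N]).
    by rewrite cardsU1 inE (negPf nk).
  apply/setP => i; rewrite !inE andb_orl; congr (_ || _).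
  by case: eqP => // ->.
apply: eq_card => i; rewrite !inE andb_orl; case: eqP => //= ->.
by rewrite leqNgt yk (negPf nk).
Qed.

(** A car that prefers [j] and is pushed to [y] or beyond has found the spots from [j] to [y - 1]
    occupied; this transfers the load bound at [j] to one at [y]. *)
Lemma occ_ge_run n (occ : {set 'I_n}) j y : (j <= y <= n)%N ->
  (forall i : 'I_n, (j <= i < y)%N -> i \in occ) ->
  occ_ge occ j = (y - j + occ_ge occ y)%N.
Proof.
elim: y => [|y IH] => jyn h; first by rewrite (_ : j = 0%N) //; lia.
have [->|jy] := eqVneq j y.+1; first by rewrite subnn.
rewrite IH; first last.
- by move=> i hi; apply: h; lia.
- lia.
have yn : (y < n)%N by lia.
have yocc : Ordinal yn \in occ by apply: h => /=; lia.
suff -> : occ_ge occ y = (occ_ge occ y.+1).+1 by lia.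
rewrite /occ_ge (_ : [set _ in _ | _] = Ordinal yn |: [set i in occ | (y < i)%N]).
  by rewrite cardsU1 !inE /= ltnn andbF.
apply/setP => i; rewrite !inE -val_eqE /= leq_eqVlt eq_sym andb_orr.
congr (_ || _); case: eqP => [e|]; rewrite ?andbF // andbT.
by rewrite (_ : i = Ordinal yn) //; apply: val_inj.
Qed.

(* The order of arrival is immaterial: only the final segments of the street
   matter, each of which must not be overloaded. *)
Lemma all_parkE n (prefs : seq 'I_n) (occ : {set 'I_n}) :
  all_park occ prefs =
  all (fun y => occ_ge occ y + count (leq y) (map val prefs) <= n - y)%N
    (iota 0 n.+1).
Proof.
elim: prefs occ => [|j s IH] occ.
  by symmetry; apply/allP => y _; rewrite addn0 occ_ge_le.
have jn := ltn_ord j.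
rewrite /=; case: first_free (first_freeP occ j) => [k [jk nk run]|full]; last first.
  symmetry; apply: negbTE; rewrite -[X in ~~ X]/(all _ (iota 0 n.+1)).
  (* Every spot from [j] on is taken, so the newcomer overloads the segment that starts at [j]. *)
  apply/allPn; exists (j : nat); first by rewrite mem_iota; lia.
  by rewrite occ_ge_full //= leqnn; lia.
have kn := ltn_ord k.
rewrite IH -[RHS]/(all _ (iota 0 n.+1)).
apply/allP/allP => h y yn; have := h _ yn; rewrite occ_geU1 //=.
  by case: (leqP y j); case: (leqP y k); lia.
(* The bounds before and after parking the car differ only when [j < y <= k], that is, when it is
   pushed across the start of the segment. The run of occupied spots from [j] then lets the bound at
   [j] imply the one at [y]. *)
case: (leqP y j) => yj; first by case: (leqP y k); lia.
case: (leqP y k) => // yk _.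
have jin : (j : nat) \in iota 0 n.+1 by rewrite mem_iota; lia.
have := h _ jin; rewrite /= leqnn (@occ_ge_run _ occ j y); first last.
- by move=> i hi; apply: run; lia.
- lia.
have /= : (count (leq y) (map val s) <= count (leq j) (map val s))%N.
  by apply: sub_count => i /=; lia.
lia.
Qed.

(** On plain sequences, the bound of [parkable] at [y = n] says that all entries are below [n], and
    the one at [y = 0] that there are at most [n] cars. From here on sequences of naturals can stand
    for tuples of ordinals. *)
Lemma mem_PF m n (pi : m.-tuple 'I_n) :
  (pi \in PF m n) = parkable n (map val pi).
Proof.
rewrite inE all_parkE; apply: eq_all => y.
rewrite (_ : occ_ge set0 y = 0%N) //.
by apply/eqP; rewrite cards_eq0; apply/eqP/setP => k; rewrite !inE.
Qed.

Lemma parkable_catr n s1 s2 : parkable n (s1 ++ s2) -> parkable n s2.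
Proof.
move=> /parkableP h; apply/parkableP => y /h; rewrite count_cat; lia.
Qed.

(** A segment that contains [x] is loaded by [s1] at least once. Consequently failure of one marked
    car implies failure of the whole marked group. *)
Lemma parkable_cons_of_mem n x s1 s2 : x \in s1 ->
  parkable n (s1 ++ s2) -> parkable n (x :: s2).
Proof.
move=> xs /parkableP h; apply/parkableP => y yn; have := h y yn.
rewrite count_cat /=; case: (leqP y x) => yx; last by lia.
suff : (0 < count (leq y) s1)%N by lia.
by rewrite -has_count; apply/hasP; exists x.
Qed.

(** Zeros enter only the bound at [y = 0], which counts all cars; the other bounds are those of the
    nonzero entries, shifted down. This yields the recursion on the length of the street. *)
Lemma parkable_succ n s :
  parkable n.+1 s =
  (size s <= n.+1)%N && parkable n (map predn (filter (leq 1) s)).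
Proof.
have cE y : count (leq y.+1) s = count (leq y) (map predn (filter (leq 1) s)).
  by rewrite count_map count_filter; apply: eq_count => i /=; lia.
apply/parkableP/andP => [h|[sz /parkableP h] [|y] yn].
- split; first by have := h 0%N isT; rewrite (eq_count (a2 := predT)) ?count_predT.
  by apply/parkableP => y yn; rewrite -cE; have := h y.+1 yn; lia.
- by rewrite (eq_count (a2 := predT)) ?count_predT.
- by rewrite cE; have := h y; lia.
Qed.

(** * Sums over sequences, and the exact number of parking functions *)

Section SeqSum.
Context {R : numFieldType}.
Implicit Types (n m : nat) (F G : seq nat -> R).

(** Iterated sums over plain sequences, instead of one sum over tuples, allow concatenation and
    deletion of entries without casts between lengths. *)
Fixpoint seqsum n m F : R :=
  if m is m'.+1 then \sum_(x < n) seqsum n m' (fun s => F (val x :: s))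
  else F [::].

Lemma eq_seqsum n m F G :
  (forall s, size s = m -> all (gtn n) s -> F s = G s) -> seqsum n m F = seqsum n m G.
Proof.
elim: m F G => [|m IH] F G FG /=; first exact: FG.
apply: eq_bigr => x _; apply: IH => s sm sn; apply: FG => /=; first by rewrite sm.
by rewrite ltn_ord.
Qed.

Lemma seqsumD n m F G :
  seqsum n m (fun s => F s + G s) = seqsum n m F + seqsum n m G.
Proof.
by elim: m F G => //= m IH F G; rewrite -big_split; apply: eq_bigr => x _; rewrite IH.
Qed.

Lemma seqsumZ n m a F : seqsum n m (fun s => a * F s) = a * seqsum n m F.
Proof.
by elim: m F => //= m IH F; rewrite mulr_sumr; apply: eq_bigr => x _; rewrite IH.
Qed.

Lemma seqsumB n m F G :
  seqsum n m (fun s => F s - G s) = seqsum n m F - seqsum n m G.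
Proof.
rewrite -[- seqsum n m G]mulN1r -seqsumZ -seqsumD; apply: eq_seqsum => s _ _.
by rewrite mulN1r.
Qed.

Lemma seqsum_sum n m (I : finType) (P : pred I) (F : I -> seq nat -> R) :
  seqsum n m (fun s => \sum_(i | P i) F i s) = \sum_(i | P i) seqsum n m (F i).
Proof.
elim: m F => //= m IH F; rewrite exchange_big; apply: eq_bigr => x _.
exact: IH.
Qed.

Lemma seqsum_cat n l m F :
  seqsum n (l + m) F = seqsum n l (fun j => seqsum n m (fun s => F (j ++ s))).
Proof. by elim: l F => //= l IH F; apply: eq_bigr => x _; rewrite IH. Qed.

Lemma seqsum_prod n l (g : 'I_l -> nat -> R) :
  seqsum n l (fun s => \prod_(i < l) g i (nth 0 s i)) =
  \prod_(i < l) \sum_(x < n) g i x.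
Proof.
elim: l g => [|l IH] g /=; first by rewrite !big_ord0.
rewrite big_ord_recl mulr_suml; apply: eq_bigr => x _.
rewrite -(IH (fun i => g (lift ord0 i))) -seqsumZ.
by apply: eq_seqsum => s _ _; rewrite big_ord_recl.
Qed.

Lemma seqsum_tuple n m F :
  \sum_(t : m.-tuple 'I_n) F (map val t) = seqsum n m F.
Proof.
elim: m F => [|m IH] F /=.
  by rewrite (big_pred1 [tuple]) // => t; apply/esym/eqP; apply: tuple0.
under [RHS]eq_bigr do rewrite -IH.
rewrite pair_big /= (reindex (fun p : 'I_n * m.-tuple 'I_n => [tuple of p.1 :: p.2])) //=.
exists (fun t : m.+1.-tuple 'I_n => (thead t, [tuple of behead t])) => [[x t]|t] _ /=.
  by congr pair; apply: val_inj.
by rewrite -tuple_eta.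
Qed.

(* Splitting a sequence over [0, n] into its k zeros and the remaining
   entries, shifted down to [0, n - 1]. *)
Lemma seqsum_zeros n m (G : nat -> seq nat -> R) :
  seqsum n.+1 m (fun s => G (count_mem 0%N s) (map predn (filter (leq 1) s))) =
  \sum_(k < m.+1) 'C(m, k)%:R * seqsum n (m - k) (G k).
Proof.
elim: m G => [|m IH] G /=; first by rewrite big_ord_recl big_ord0 bin0 mul1r addr0.
rewrite big_ord_recl /= (IH (fun k => G k.+1)).
under [X in _ + X]eq_bigr => x _ do rewrite (IH (fun k s => G k (val x :: s))).
rewrite exchange_big /=.
under [X in _ + X]eq_bigr => k _ do
  rewrite -mulr_sumr -[\sum_(i < n) _]/(seqsum n (m - k).+1 (G k)).
rewrite [RHS]big_ord_recl bin0.
(* Pascal's rule: one half matches the sequences with first entry zero; the other half, with the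
   term [k = 0], those with nonzero first entry. *)
under [X in _ = _ + X]eq_bigr => k _ do rewrite /= subSS binS natrD mulrDl.
rewrite big_split /= [RHS]addrA [RHS]addrC; congr (_ + _).
rewrite big_ord_recl [in RHS]big_ord_recr /= (bin_small (ltnSn m)) mulr0n mul0r addr0 bin0 !subn0.
congr (_ + _); apply: eq_bigr => k _ /=.
rewrite -[\sum_(x < n) _]/(seqsum n (m - bump 0 k).+1 (G (bump 0 k))).
by have -> : (m - bump 0 k).+1 = (m - k)%N by rewrite /bump; have := ltn_ord k; lia.
Qed.

Lemma seqsum_const n m a : seqsum n m (fun=> a) = n%:R ^+ m * a.
Proof.
elim: m => [|m IH] /=; first by rewrite mul1r.
by rewrite IH sumr_const card_ord exprS -mulrA mulr_natl.
Qed.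

Lemma sum_binX m (x : R) :
  \sum_(k < m.+1) 'C(m, k)%:R * x ^+ (m - k) = (x + 1) ^+ m.
Proof.
by rewrite exprDn; apply: eq_bigr => k _; rewrite expr1n mulr1 mulr_natl.
Qed.

(* The derivative of the binomial formula, multiplied by x to avoid the
   truncated exponent m - k - 1. *)
Lemma sum_binXn m (x : R) :
  \sum_(k < m.+1) 'C(m, k)%:R * ((m - k)%:R * x ^+ (m - k)) =
  m%:R * x * (x + 1) ^+ m.-1.
Proof.
case: m => [|m]; first by rewrite big_ord1 sub0n !mul0r mulr0.
rewrite big_ord_recr /= subnn mul0r mulr0 addr0 -sum_binX mulr_sumr.
apply: eq_bigr => k _; rewrite subSn -1?ltnS // exprS.
have -> : 'C(m.+1, k)%:R * ((m - k).+1%:R * (x * x ^+ (m - k))) =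
  (('C(m.+1, k) * (m - k).+1)%N)%:R * (x * x ^+ (m - k)) by rewrite natrM mulrA.
suff -> : ('C(m.+1, k) * (m - k).+1 = m.+1 * 'C(m, k))%N by rewrite natrM; ring.
by have := mul_bin_down m.+1 k; rewrite subSn -1?ltnS //=; lia.
Qed.

Definition parkind n s : R := (parkable n s)%:R.
Definition npark n m : R := seqsum n m (parkind n).

Lemma npark_over n m : (n < m)%N -> npark n m = 0.
Proof.
move=> nm; rewrite /npark (@eq_seqsum _ _ _ (fun=> 0)) ?seqsum_const ?mulr0 //.
move=> s sm _; rewrite /parkind (_ : parkable n s = false) //.
apply/negP => /parkableP /(_ 0%N isT).
by rewrite (eq_count (a2 := predT)) // count_predT; lia.
Qed.

Lemma npark_succ n m : (m <= n.+1)%N ->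
  npark n.+1 m = \sum_(k < m.+1) 'C(m, k)%:R * npark n (m - k).
Proof.
move=> mn; apply: etrans (seqsum_zeros n m (fun=> parkind n)); apply: eq_seqsum => s sm _.
by rewrite /parkind parkable_succ sm mn.
Qed.

(** By induction on [n], [npark_succ] reduces the count to the sums [sum_binX] and [sum_binXn] at
    [x = n.+1]. The range includes [m = n.+1], where both sides vanish, because the induction step
    calls on that case. *)
Lemma nparkE n m : (m <= n.+1)%N ->
  n.+1%:R * npark n m = (n.+1 - m)%:R * n.+1%:R ^+ m.
Proof.
have over k : npark k k.+1 = 0 by apply: npark_over.
elim: n m => [|n IH] m mn.
  case: m mn => [|[|//]] _; last by rewrite over mulr0 mul0r.
  by rewrite /npark /= /parkind expr0.
have [->|nm] := eqVneq m n.+2; first by rewrite over subnn mul0r mulr0.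
have {nm}mn : (m <= n.+1)%N by lia.
have x0 : (n.+1%:R : R) != 0 by rewrite pnatr_eq0.
(* The extra factor [n.+1] puts each summand in the form treated by the induction hypothesis. *)
apply: (mulfI x0); rewrite mulrCA npark_succ // mulr_sumr.
under eq_bigr => k _.
  rewrite mulrCA IH ?(leq_trans (leq_subr _ _) mn) //.
  have km : (m - k <= n.+1)%N by apply: leq_trans mn; apply: leq_subr.
  rewrite natrB // mulrBl mulrBr mulrCA; over.
rewrite sumrB -mulr_sumr sum_binX sum_binXn natrB; last exact: leqW.
rewrite -!(natr1 n.+1).
case: m {mn} => [|m] /=; rewrite ?exprS; ring.
Qed.
End SeqSum.

(** * Concentration of [spill] near the end of the street *)

Section Spill.
Context {R : realType}.
Implicit Types (n m x y : nat) (F G : seq nat -> R).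

Lemma ler_seqsum n m F G :
  (forall s, size s = m -> all (gtn n) s -> F s <= G s) ->
  seqsum n m F <= seqsum n m G.
Proof.
elim: m F G => [|m IH] F G FG /=; first exact: FG.
apply: ler_sum => x _; apply: IH => s sm sn; apply: FG => /=; first by rewrite sm.
by rewrite ltn_ord.
Qed.

Lemma ler_norm_seqsum n m F : `|seqsum n m F| <= seqsum n m (fun s => `|F s|).
Proof.
elim: m F => //= m IH F; apply: le_trans (ler_norm_sum _ _ _) _.
by apply: ler_sum => x _; apply: IH.
Qed.

(* The summand is an indicator, a parking function remaining one when a car is
   removed. *)
Definition spill n m x : R :=
  seqsum n m (fun s => parkind n s - parkind n (x :: s)).

Lemma spill_ge0 n m x : 0 <= spill n m x.
Proof.
have <- : seqsum n m (fun=> 0) = 0 :> R by rewrite seqsum_const mulr0.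
apply: ler_seqsum => s _ _; rewrite subr_ge0 /parkind ler_nat.
by case H : (parkable n (x :: s)) => //; rewrite (@parkable_catr n [:: x] s).
Qed.

(** The preference of the extra car, summed over all spots, becomes the first entry of a longer
    sequence, so [nparkE] gives the total mass exactly. *)
Lemma sum_spill n m :
  \sum_(x < n) spill n m x = n%:R * npark n m - npark n m.+1.
Proof.
under eq_bigr do rewrite /spill seqsumB.
by rewrite sumrB sumr_const card_ord mulr_natl.
Qed.

(* Markov's inequality for t ^ (number of cars preferring a spot >= y). *)
Lemma spill_le n m x (t : R) : (x < n)%N -> 1 <= t ->
  spill n m x <= \sum_(y < n | (y <= x)%N)
    t ^- (n - y) * (y%:R + t * (n - y)%:R) ^+ m.
Proof.
move=> xn t1; have t0 : 0 < t by apply: lt_le_trans t1.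
(* The sum factors over the entries: each contributes [1] for a spot before [y] and [t] for a later
   one. *)
have expE y : (y < n)%N ->
    (y%:R + t * (n - y)%:R) ^+ m = seqsum n m (fun s => t ^+ count (leq y) s).
  move=> yn; have := seqsum_prod n (fun (_ : 'I_m) z => if (y <= z)%N then t else 1).
  rewrite prodr_const card_ord => /esym e; transitivity ((\sum_(z < n) (if (y <= z)%N then t else 1)) ^+ m).
    congr (_ ^+ m); rewrite -(big_mkord xpredT (fun z => if (y <= z)%N then t else 1)).
    rewrite (@big_cat_nat _ _ _ y) //=; last exact: ltnW.
    rewrite (@eq_big_nat _ _ _ 0 y _ (fun=> 1)); last by move=> i /andP[_ iy]; rewrite leqNgt iy.
    rewrite (@eq_big_nat _ _ _ y n _ (fun=> t)); last by move=> i /andP[->].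
    by rewrite !sumr_const_nat subn0 mulr_natr.
  rewrite e; apply: eq_seqsum => s sm _.
  rewrite -big_mkcond /= -(big_mkord (fun i => (y <= nth 0 s i)%N) (fun=> t)).
  by rewrite -sm -(big_nth 0%N (leq y) (fun=> t)) big_const_seq iter_mulr mulr1.
under eq_bigr => y _ do rewrite expE // -seqsumZ.
rewrite -seqsum_sum; apply: ler_seqsum => s _ sn.
have term_ge0 (y : 'I_n) : 0 <= t ^- (n - y) * t ^+ count (leq y) s.
  by rewrite mulr_ge0 ?invr_ge0 ?exprn_ge0 // ltW.
have sum_ge0 : 0 <= \sum_(y < n | (y <= x)%N) t ^- (n - y) * t ^+ count (leq y) s.
  by apply: sumr_ge0.
rewrite /parkind; case: (parkable n s) / parkableP => [sP|_]; last first.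
  by rewrite (le_trans _ sum_ge0) // sub0r oppr_le0 ler0n.
case: (boolP (parkable n (x :: s))) => [_|/allPn[y]]; first by rewrite subrr.
rewrite mem_iota /= => yn; rewrite -ltnNge subr0.
(* Adding [x] only raises the counts at [y <= x]. A violated [y] is therefore at most [x] and was
   already saturated by [s], so its summand is at least [1]. *)
have := sP y; case: (leqP y x) => yx; last by lia.
move=> _ ys; have {}yn : (y < n)%N by lia.
rewrite (bigD1 (Ordinal yn)) //= -[leLHS]addr0 lerD ?sumr_ge0 //.
rewrite ler_pdivlMl ?exprn_gt0 // mulr1 ler_weXn2l //; lia.
Qed.

(** Replace the square by [(i + 1) * (i + 2)]: the resulting series is the second derivative of the
    geometric series, with sum [2 / (1 - r) ^ 3]. *)
Lemma sum_sqr_exp_le (r : R) k : 0 <= r -> r < 1 ->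
  \sum_(i < k) (i.+1)%:R ^+ 2 * r ^+ i <= 2 / (1 - r) ^+ 3.
Proof.
move=> r0 r1; have r10 : 0 < 1 - r by lra.
rewrite ler_pdivlMr ?exprn_gt0 // mulr_suml.
(* This is [(1 - r) ^ 3] times the partial sum with weights [(i + 1) * (i + 2)]. *)
apply: (@le_trans _ _ (2 - r ^+ k * ((k.+1 * k.+2)%:R - 2 * (k * k.+2)%:R * r + (k * k.+1)%:R * r ^+ 2))).
  elim: k => [|k IH]; first by rewrite big_ord0 expr0 !mul0n; lra.
  rewrite big_ord_recr /=; apply: (le_trans (lerD IH (lexx _))).
  rewrite -subr_ge0 !natrM -![_.+3%:R]natr1 -![_.+2%:R]natr1 -![_.+1%:R]natr1 exprS.
  have : 0 <= r ^+ k * (k%:R + 1) * (1 - r) ^+ 3 by rewrite natr1 !mulr_ge0 ?exprn_ge0 // ltW.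
  move=> /le_trans; apply; rewrite le_eqVlt; apply/orP; left; apply/eqP; ring.
rewrite gerBl mulr_ge0 ?exprn_ge0 //.
have k0 : 0 <= k%:R :> R by [].
rewrite (_ : _ - _ + _ = (k%:R * (1 - r)) ^+ 2 + k%:R * (1 - r) * (3 - r) + 2).
  by rewrite !addr_ge0 ?sqr_ge0 // !mulr_ge0 //; lra.
rewrite !natrM -!natr1; ring.
Qed.

(** The factor gained per spot of distance from the end when [spill_le] is applied with
    [t = 1 / c]. *)
Definition chernoff (c : R) : R := c * expR (1 - c).

Lemma chernoff_gt0 c : 0 < c -> 0 < chernoff c.
Proof. by move=> c0; rewrite mulr_gt0 ?expR_gt0. Qed.

(** The strict inequality [1 + x < expR x] at [x = c - 1]. *)
Lemma chernoff_lt1 c : 0 < c -> c < 1 -> chernoff c < 1.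
Proof.
move=> c0 c1; rewrite /chernoff -[1 - c]opprB expRN -ltr_pdivlMr ?invr_gt0 ?expR_gt0 //.
by rewrite invrK mul1r; rewrite -[ltLHS](_ : 1 + (c - 1) = c) ?expR_gt1Dx ?subr_eq0 ?lt_eqF //; ring.
Qed.

(** Converts the power [n ^ m] of the Chernoff bound into a multiple of the number of parking
    functions. *)
Lemma npark_ge (c : R) n m : (0 < n)%N -> m%:R <= c * n%:R -> 0 < c -> c < 1 ->
  (1 - c) * n%:R ^+ m <= npark n m.
Proof.
move=> n0 mn c0 c1.
have mn' : (m <= n)%N.
  rewrite -(ler_nat R); apply: (le_trans mn); rewrite ler_piMl //; lra.
have n1 : 0 < n.+1%:R :> R by rewrite ltr0n.
rewrite -(ler_pM2l n1) nparkE; last exact: leqW.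
rewrite mulrCA [leLHS]mulrA ler_pM //.
- rewrite mulr_ge0 //; lra.
- exact: exprn_ge0.
- rewrite natrB ?leqW // -natr1; lra.
- by rewrite lerXn2r ?nnegrE // ler_nat.
Qed.

(** Relative to [npark], the distance to the end has a first moment bounded uniformly in [n]. The
    hypothesis on [m] is an inequality because the bound serves for [m - l] cars. *)
Lemma spill_moment (c : R) n m : (0 < n)%N -> 0 < c -> c < 1 -> m%:R <= c * n%:R ->
  \sum_(x < n) (n - x)%:R * spill n m x <=
  2 / ((1 - c) * (1 - chernoff c) ^+ 3) * npark n m.
Proof.
move=> n0 c0 c1 mcn.
have r1 := chernoff_lt1 c0 c1; have r0 := chernoff_gt0 c0.
have n0' : 0 < n%:R :> R by rewrite ltr0n.
(* The choice [t = 1 / c] minimises [t ^ (- k) * expR (c * (t - 1) * k)], the exponential form of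
   the bound. *)
have t1 : 1 <= c^-1 by rewrite invr_ge1 ?unitfE ?gt_eqF // ltW.
have c10 : 0 < 1 - c by lra.
have bnd y : (y < n)%N -> c^-1 ^- (n - y) * (y%:R + c^-1 * (n - y)%:R) ^+ m <=
    n%:R ^+ m * chernoff c ^+ (n - y).
  move=> yn; rewrite exprVn invrK /chernoff exprMn [leRHS]mulrCA ler_pM2l ?exprn_gt0 //.
  set k := (n - y)%:R : R.
  have -> : y%:R + c^-1 * k = n%:R * (1 + (c^-1 - 1) * k / n%:R).
    by rewrite /k natrB ?(ltnW yn) //; field; rewrite !gt_eqF.
  rewrite exprMn ler_pM2l ?exprn_gt0 // -expRM_natl.
  apply: (@le_trans _ _ (expR ((c^-1 - 1) * k / n%:R) ^+ m)).
    rewrite lerXn2r ?nnegrE ?expR_ge0 ?expR_ge1Dx //.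
    by rewrite addr_ge0 // !mulr_ge0 ?invr_ge0 // subr_ge0.
  rewrite -expRM_natl ler_expR -/k.
  have -> : k * (1 - c) = (c * n%:R) * ((c^-1 - 1) * k / n%:R).
    by field; rewrite !gt_eqF.
  by rewrite ler_wpM2r // !mulr_ge0 ?invr_ge0 // subr_ge0.
have step : \sum_(x < n) (n - x)%:R * spill n m x <=
    \sum_(x < n) \sum_(y < n | (y <= x)%N) (n - y)%:R * (n%:R ^+ m * chernoff c ^+ (n - y)).
  apply: ler_sum => x _; apply: (le_trans (ler_wpM2l (ler0n _ _) (spill_le m (ltn_ord x) t1))).
  rewrite mulr_sumr; apply: ler_sum => y yx; apply: ler_pM => //.
  - have ci0 : 0 <= c^-1 by rewrite invr_ge0 ltW.
    by rewrite mulr_ge0 // ?exprn_ge0 // ?addr_ge0 // ?mulr_ge0 // invr_ge0 exprn_ge0.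
  - by rewrite ler_nat leq_sub2l.
  - exact: bnd.
apply: (le_trans step); rewrite (exchange_big_dep predT) //=.
(* There are [n - y] values of [x] from [y] on, which squares the weight; the index is then reversed
   to [i = n - 1 - y]. *)
have -> : \sum_(y < n) \sum_(x < n | (y <= x)%N) (n - y)%:R * (n%:R ^+ m * chernoff c ^+ (n - y)) =
  n%:R ^+ m * chernoff c * \sum_(i < n) i.+1%:R ^+ 2 * chernoff c ^+ i.
  rewrite mulr_sumr (reindex_inj rev_ord_inj); apply: eq_bigr => y _ /=.
  rewrite subKn // sumr_const.
  have -> : #|[pred x : 'I_n | (n - y.+1 <= x)%N]| = y.+1.
    transitivity (occ_ge [set: 'I_n] (n - y.+1)); last by rewrite occ_ge_setT subKn.
    by apply: eq_card => x; rewrite !inE.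
  by rewrite -[_ *+ y.+1]mulr_natl exprS; ring.
have s0 := sum_sqr_exp_le n (ltW r0) r1.
have r10 : 0 < 1 - chernoff c by lra.
apply: (@le_trans _ _ (n%:R ^+ m * (2 / (1 - chernoff c) ^+ 3))).
  rewrite -mulrA ler_wpM2l ?exprn_ge0 //; apply: (le_trans _ s0).
  rewrite ler_piMl ?(ltW r1) ?sumr_ge0 // => i _.
  by rewrite mulr_ge0 ?exprn_ge0 // ltW.
have K0 : 0 <= 2 / ((1 - c) * (1 - chernoff c) ^+ 3).
  by rewrite divr_ge0 ?mulr_ge0 ?exprn_ge0 ?ltW.
apply: le_trans (ler_wpM2l K0 (npark_ge n0 mcn c0 c1)).
rewrite le_eqVlt; apply/orP; left; apply/eqP; field.
by rewrite !gt_eqF.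
Qed.
End Spill.

(** * Inclusion-exclusion for several marked cars *)

Section Overlap.
Context {R : realType}.
Implicit Types (n m l : nat) (j s : seq nat).

(* The inclusion-exclusion defect: the parking functions which cannot
   accommodate all of j, minus those failing for each single entry of j. *)
Definition overlap n m j : R :=
  npark n m - seqsum n m (fun s => parkind n (j ++ s)) - \sum_(x <- j) spill n m x.

Lemma overlapE n m l j : size j = l ->
  overlap n m j = npark n m - seqsum n m (fun s => parkind n (j ++ s))
                  - \sum_(i < l) spill n m (nth 0%N j i).
Proof. by move=> <-; rewrite /overlap (big_nth 0%N) big_mkord. Qed.

Lemma prod_one_factor l (i : 'I_l) (a v : 'I_l -> R) :
  \prod_k (if k == i then a k else v k) = a i * \prod_(k | k != i) v k.
Proof.
rewrite (bigD1 i) //= eqxx; congr (_ * _).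
by apply: eq_bigr => k /negPf ->.
Qed.

(** The definition of [overlap], solved for the number of ways to complete [j], is summed against a
    product weight. All terms but the one with [overlap] then factor over the coordinates. *)
Lemma seqsum_weighted_parkind n m l (g : 'I_l -> nat -> R) :
  seqsum n (l + m) (fun s => (\prod_(i < l) g i (nth 0%N s i)) * parkind n s) =
  npark n m * \prod_(i < l) \sum_(x < n) g i x
  - \sum_(i < l) (\sum_(x < n) g i x * spill n m x)
                 * \prod_(k < l | k != i) \sum_(x < n) g k x
  - seqsum n l (fun j => (\prod_(i < l) g i (nth 0%N j i)) * overlap n m j).
Proof.
rewrite seqsum_cat.
pose w j := \prod_(i < l) g i (nth 0%N j i).
(* Writing the term as a product with [spill] in the factor [i] alone makes [seqsum_prod]
   applicable. *)
pose wi (i : 'I_l) j := \prod_(k < l)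
  (if k == i then g k (nth 0%N j k) * spill n m (nth 0%N j k) else g k (nth 0%N j k)).
rewrite (@eq_seqsum _ _ _ _ (fun j => npark n m * w j
  - \sum_(i < l) wi i j - w j * overlap n m j)); last first.
  move=> j jl _; rewrite (overlapE _ _ jl).
  rewrite (@eq_seqsum _ _ _ _ (fun s => w j * parkind n (j ++ s))); last first.
    move=> s _ _; congr (_ * _); apply: eq_bigr => i _.
    by rewrite nth_cat jl ltn_ord.
  rewrite seqsumZ (_ : \sum_(i < l) wi i j = w j * \sum_(i < l) spill n m (nth 0%N j i)); first by ring.
  rewrite mulr_sumr; apply: eq_bigr => i _.
  rewrite /wi (prod_one_factor i (fun k => _ * _) (fun k => g k _)).
  by rewrite /w [X in _ = X * _](bigD1 i) //= mulrAC.
rewrite !seqsumB seqsumZ seqsum_sum seqsum_prod; congr (_ - _ - _).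
apply: eq_bigr => i _.
rewrite (seqsum_prod n (fun k x => if k == i then g k x * spill n m x else g k x)).
rewrite -(prod_one_factor i (fun k => \sum_(x < n) g k x * spill n m x)).
by apply: eq_bigr => k _; case: eqP.
Qed.

(** Discard the largest [a i], which is at most [D]; every other one equals its minimum with the
    largest. *)
Lemma sum_sub_le_sum_min l (a : 'I_l -> R) (D : R) : 0 <= D ->
  (forall i, 0 <= a i <= D) ->
  \sum_i a i - D <= \sum_i \sum_(k | k != i) Num.min (a i) (a k).
Proof.
case: l a => [|l] a D0 aD; first by rewrite !big_ord0 sub0r oppr_le0.
have min0 i k : 0 <= Num.min (a i) (a k).
  by rewrite le_min; case/andP: (aD i) => -> _; case/andP: (aD k) => ->.
pose i0 := [arg max_(i > ord0) a i]%O.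
have i0P i : a i <= a i0 by rewrite /i0; case: arg_maxP => // i1 _; apply.
rewrite (bigD1 i0) //= [leRHS](bigD1 i0) //=.
apply: (@le_trans _ _ (\sum_(i | i != i0) a i)).
  by rewrite lerBlDr addrC lerD2l; case/andP: (aD i0).
rewrite -[leLHS]addr0 lerD //; last by do 2![apply: sumr_ge0 => ? _].
by apply: ler_sum => i _; rewrite le_min i0P lexx.
Qed.

(** Here [D] counts the joint failures of [j] and dominates each single [spill], so
    [sum_sub_le_sum_min] applies. *)
Lemma overlap_lower n m l j : size j = l ->
  - \sum_(i < l) \sum_(k < l | k != i)
      Num.min (spill n m (nth 0%N j i)) (spill n m (nth 0%N j k))
  <= overlap n m j.
Proof.
move=> jl; rewrite (overlapE _ _ jl) -lerN2 opprK opprB.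
apply: sum_sub_le_sum_min.
  rewrite subr_ge0; apply: ler_seqsum => s _ _; rewrite /parkind ler_nat.
  by case H : (parkable n (j ++ s)) => //; rewrite (parkable_catr H).
move=> i; rewrite spill_ge0 /= /spill seqsumB lerD2l lerN2.
apply: ler_seqsum => s _ _; rewrite /parkind ler_nat.
case H : (parkable n (j ++ s)) => //.
by rewrite (parkable_cons_of_mem _ H) ?mem_nth ?jl.
Qed.

(** The minimum is at most [spill] at the smaller entry [z], and the other entry then has [n - z]
    possible values. The factor [2] covers the two orders; [n ^ 2] avoids the exponent [l - 2]. *)
Lemma seqsum_min_spill n m l (i k : 'I_l) : i != k ->
  n%:R ^+ 2 * seqsum n l (fun j =>
    Num.min (spill n m (nth 0%N j i)) (spill n m (nth 0%N j k))) <=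
  2 * n%:R ^+ l * \sum_(x < n) (n - x)%:R * spill n m x :> R.
Proof.
move=> ik.
(* The product of [h i k z] over the coordinates indicates that entry [i] equals [z] and entry [k]
   is at least [z]. *)
pose h (i k : 'I_l) (z : 'I_n) (q : 'I_l) (x : nat) : R :=
  if q == i then (x == z)%:R else if q == k then (z <= x)%:R else 1.
have hE i' k' z j : i' != k' -> \prod_q h i' k' z q (nth 0%N j q) =
    (nth 0%N j i' == z)%:R * (z <= nth 0%N j k')%:R :> R.
  move=> ik'; rewrite /h (bigD1 i') //= (bigD1 k') 1?eq_sym //= !eqxx.
  rewrite (eq_sym k') (negPf ik') big1 ?mulr1 //.
  by move=> q /andP[/negPf -> /negPf ->].
have hS i' k' z : i' != k' ->
    n%:R ^+ 2 * seqsum n l (fun j => \prod_q h i' k' z q (nth 0%N j q)) =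
    n%:R ^+ l * (n - z)%:R :> R.
  move=> ik'; rewrite seqsum_prod -[in RHS](card_ord l) -prodr_const.
  have ki' : k' != i' by rewrite eq_sym.
  rewrite (bigD1 i') //= (bigD1 k') //= [in RHS](bigD1 i') //= [in RHS](bigD1 k') //=.
  rewrite /h !eqxx (negPf ki').
  under [X in _ * (_ * (_ * X))]eq_bigr => q /andP[/negPf -> /negPf ->] do
    rewrite sumr_const card_ord.
  have -> : \sum_(x < n) ((x : nat) == z)%:R = 1 :> R.
    by rewrite (bigD1 z) //= eqxx big1 ?addr0 // => x /negPf; rewrite -val_eqE => ->.
  have -> : \sum_(x < n) (z <= x)%:R = (n - z)%:R :> R.
    rewrite -natr_sum -(occ_ge_setT n z) /occ_ge -sum1_card [in RHS]big_mkcond.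
    by congr (_%:R); apply: eq_bigr => x _; rewrite !inE /=; case: leqP.
  ring.
have minE j : size j = l -> all (gtn n) j ->
   Num.min (spill n m (nth 0%N j i)) (spill n m (nth 0%N j k)) <=
   \sum_(z < n) spill n m z * ((\prod_q h i k z q (nth 0%N j q))
                               + \prod_q h k i z q (nth 0%N j q)).
  move=> jl /allP jn; set x := nth 0%N j i; set y := nth 0%N j k.
  have xn : (x < n)%N by apply: jn; rewrite mem_nth ?jl.
  have yn : (y < n)%N by apply: jn; rewrite mem_nth ?jl.
  have ki : k != i by rewrite eq_sym.
  have t0 (z : 'I_n) : 0 <= spill n m z * ((\prod_q h i k z q (nth 0%N j q))
                               + \prod_q h k i z q (nth 0%N j q)).
    by rewrite mulr_ge0 ?spill_ge0 // !hE // addr_ge0 // mulr_ge0.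
  case: (leqP x y) => [xy|/ltnW yx].
    rewrite (bigD1 (Ordinal xn)) //= !hE //= -/x -/y eqxx xy mulr1.
    rewrite -[leLHS]addr0 lerD ?sumr_ge0 // ge_min ler_peMr ?spill_ge0 //.
    by rewrite lerDl mulr_ge0.
  rewrite (bigD1 (Ordinal yn)) //= !hE //= -/x -/y eqxx yx mulr1.
  rewrite -[leLHS]addr0 lerD ?sumr_ge0 // ge_min ler_peMr ?spill_ge0 ?orbT //.
  by rewrite lerDr mulr_ge0.
apply: (@le_trans _ _ (n%:R ^+ 2 * seqsum n l (fun j => \sum_(z < n) spill n m z *
   ((\prod_q h i k z q (nth 0%N j q)) + \prod_q h k i z q (nth 0%N j q))))).
  by rewrite ler_wpM2l ?exprn_ge0 // ler_seqsum.
rewrite seqsum_sum.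
under eq_bigr => z _ do rewrite seqsumZ seqsumD.
rewrite !mulr_sumr; apply: ler_sum => z _.
rewrite mulrCA mulrDr !hS // 1?eq_sym //.
by rewrite le_eqVlt; apply/orP; left; apply/eqP; ring.
Qed.

(** If [v >= - w] with [w >= 0], then [|v| <= v + 2 * w]. So the signed total and the lower bound
    suffice; the constant [4] combines this [2] with that of [seqsum_min_spill], and [l ^ 2] bounds
    the number of pairs. *)
Lemma overlap_norm n m l : (0 < n)%N ->
  n%:R ^+ 2 * seqsum n l (fun j => `|overlap n m j|) <=
  n%:R ^+ 2 * seqsum n l (overlap n m)
  + 4 * l%:R ^+ 2 * n%:R ^+ l * \sum_(x < n) (n - x)%:R * spill n m x :> R.
Proof.
move=> n0; set Q := \sum_(x < n) _.
pose mm j : R := \sum_(i < l) \sum_(k < l | k != i)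
      Num.min (spill n m (nth 0%N j i)) (spill n m (nth 0%N j k)).
have Q0 : 0 <= Q by apply: sumr_ge0 => x _; rewrite mulr_ge0 ?spill_ge0.
have mm0 j : 0 <= mm j.
  by do 2![apply: sumr_ge0 => ? _]; rewrite le_min !spill_ge0.
have mmS : n%:R ^+ 2 * seqsum n l mm <= l%:R ^+ 2 * (2 * n%:R ^+ l * Q).
  rewrite seqsum_sum mulr_sumr.
  under eq_bigr => i _ do rewrite seqsum_sum mulr_sumr.
  have -> : l%:R ^+ 2 * (2 * n%:R ^+ l * Q) = \sum_(i < l) \sum_(k < l) (2 * n%:R ^+ l * Q).
    by rewrite !sumr_const card_ord -mulrnA -[RHS]mulr_natl natrM.
  apply: ler_sum => i _; rewrite big_mkcond; apply: ler_sum => k _.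
  case: eqP => [_|/eqP ki] /=; last by apply: seqsum_min_spill; rewrite eq_sym.
  by rewrite !mulr_ge0 ?exprn_ge0.
have -> : 4 * l%:R ^+ 2 * n%:R ^+ l * Q = 2 * (l%:R ^+ 2 * (2 * n%:R ^+ l * Q)) by ring.
apply: (@le_trans _ _ (n%:R ^+ 2 * seqsum n l (overlap n m) + 2 * (n%:R ^+ 2 * seqsum n l mm))).
  rewrite mulrCA -mulrDr -(seqsumZ n l 2) -seqsumD ler_wpM2l ?exprn_ge0 //.
  apply: ler_seqsum => j jl _; have := overlap_lower n m jl; rewrite -/(mm j) => h.
  have := mm0 j; rewrite ler_norml; lra.
by rewrite lerD2l ler_pM2l.
Qed.
End Overlap.

(** * Calculus of two-term expansions in [1 / n] *)

Section Expansion.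
Context {R : realType} (c : R).
Implicit Types (F G : nat -> nat -> R) (a b K : R) (m n : nat).

(** The relation [F = a + b / n + O(1 / n ^ 2)] along [m = c n]. Keeping [m] as an argument makes
    integrality of [c n] a hypothesis, without rounding. *)
Definition expansion F a b : Prop :=
  exists K N, forall m n, (N <= n)%N -> m%:R = c * n%:R ->
    `|F m n - (a + b / n%:R)| <= K / n%:R ^+ 2.

Lemma expansion_pos F a b : expansion F a b ->
  exists K N, [/\ 0 <= K, (0 < N)%N & forall m n, (N <= n)%N -> m%:R = c * n%:R ->
    `|F m n - (a + b / n%:R)| <= K / n%:R ^+ 2].
Proof.
move=> [K [N h]]; exists `|K|, N.+1; split=> // m n Nn mn.
apply: le_trans (h m n (ltnW Nn) mn) _.
by rewrite ler_wpM2r ?invr_ge0 ?exprn_ge0 // ler_norm.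
Qed.

Lemma expansion_close F G a b K N :
  (forall m n, (N <= n)%N -> m%:R = c * n%:R -> `|F m n - G m n| <= K / n%:R ^+ 2) ->
  expansion G a b -> expansion F a b.
Proof.
move=> FG [K' [N' h]]; exists (K + K'), (maxn N N') => m n.
rewrite geq_max => /andP[Nn N'n] mn; rewrite mulrDl.
rewrite (_ : F m n - _ = (F m n - G m n) + (G m n - (a + b / n%:R))); last by ring.
by apply: le_trans (ler_normD _ _) _; rewrite lerD ?FG ?h.
Qed.

Lemma expansion_eq F G a b N :
  (forall m n, (N <= n)%N -> m%:R = c * n%:R -> F m n = G m n) ->
  expansion G a b -> expansion F a b.
Proof.
move=> FG; apply: (@expansion_close _ _ _ _ 0 N) => m n Nn mn.
by rewrite FG // subrr normr0 mul0r.
Qed.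

Lemma expansion_affine a b : expansion (fun _ n => a + b / n%:R) a b.
Proof. by exists 0, 0%N => m n _ _; rewrite subrr normr0 mul0r. Qed.

Lemma expansion_cst a : expansion (fun _ _ => a) a 0.
Proof. by exists 0, 0%N => m n _ _; rewrite mul0r addr0 subrr normr0 mul0r. Qed.

Lemma expansionD F G a b a' b' : expansion F a b -> expansion G a' b' ->
  expansion (fun m n => F m n + G m n) (a + a') (b + b').
Proof.
move=> [K [N h]] [K' [N' h']]; exists (K + K'), (maxn N N') => m n.
rewrite geq_max => /andP[Nn N'n] mn; rewrite !mulrDl.
rewrite (_ : _ - _ = (F m n - (a + b / n%:R)) + (G m n - (a' + b' / n%:R))); last by ring.
by apply: le_trans (ler_normD _ _) _; rewrite lerD ?h ?h'.
Qed.

Lemma expansionM F G a b a' b' : expansion F a b -> expansion G a' b' ->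
  expansion (fun m n => F m n * G m n) (a * a') (a * b' + a' * b).
Proof.
move=> /expansion_pos[K [N [K0 N0 h]]] /expansion_pos[K' [N' [K'0 N'0 h']]].
exists (`|b * b'| + K * (`|a'| + `|b'| + K') + K' * (`|a| + `|b|)), (maxn N N') => m n.
rewrite geq_max => /andP[Nn N'n] mn.
have n1 : (0 < n)%N by lia.
have := h m n Nn mn; have := h' m n N'n mn.
set r := F m n - _; set r' := G m n - _ => hr' hr.
have n0 : n%:R != 0 :> R by rewrite pnatr_eq0 -lt0n.
have i1 : n%:R^-1 <= 1 :> R by rewrite invf_le1 ?ler1n ?ltr0n.
have i0 : 0 <= n%:R^-1 :> R by rewrite invr_ge0.
have i2 : n%:R ^- 2 <= 1 :> R by rewrite invf_le1 ?exprn_gt0 ?ltr0n // exprn_ege1 // ler1n.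
(* All contributions of order two and above are isolated here; [1 / n <= 1] then absorbs them into
   the constant. *)
have -> : F m n * G m n - (a * a' + (a * b' + a' * b) / n%:R) =
   b * b' / n%:R ^+ 2 + r * (a' + b' / n%:R + r') + r' * (a + b / n%:R).
  by rewrite /r /r'; field.
rewrite !mulrDl; do 2?[apply: le_trans (ler_normD _ _) _; apply: lerD].
- by rewrite normrM [`|_ ^- 2|]ger0_norm // invr_ge0 exprn_ge0.
- rewrite -!mulrDl mulrAC normrM ler_pM //.
  apply: le_trans (ler_normD _ _) _; apply: lerD.
    apply: le_trans (ler_normD _ _) _; rewrite lerD2l normrM (ger0_norm i0).
    by rewrite ler_piMr.
  by apply: le_trans hr' _; rewrite ler_piMr.
- rewrite -!mulrDl mulrAC normrM ler_pM //.
  apply: le_trans (ler_normD _ _) _; rewrite lerD2l normrM (ger0_norm i0).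
  by rewrite ler_piMr.
Qed.

Lemma expansionZ k F a b : expansion F a b ->
  expansion (fun m n => k * F m n) (k * a) (k * b).
Proof.
move=> /(expansionM (expansion_cst k)); rewrite mulr0 addr0; exact.
Qed.

Lemma expansion_sum (I : finType) (F : I -> nat -> nat -> R) (a b : I -> R) :
  (forall i, expansion (F i) (a i) (b i)) ->
  expansion (fun m n => \sum_i F i m n) (\sum_i a i) (\sum_i b i).
Proof.
move=> h; elim: (index_enum I) => [|i s IH].
  rewrite !big_nil; apply: (expansion_eq (N := 0%N) _ (expansion_cst 0)) => m n _ _.
  by rewrite big_nil.
rewrite !big_cons.
by apply: (expansion_eq (N := 0%N) _ (expansionD (h i) IH)) => m n _ _; rewrite big_cons.
Qed.

Lemma expansion_prod (I : finType) (P : pred I) (F : I -> nat -> nat -> R) (b : I -> R) :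
  (forall i, expansion (F i) 1 (b i)) ->
  expansion (fun m n => \prod_(i | P i) F i m n) 1 (\sum_(i | P i) b i).
Proof.
move=> h; elim: (index_enum I) => [|i s IH].
  rewrite big_nil; apply: (expansion_eq (N := 0%N) _ (expansion_cst 1)) => m n _ _.
  by rewrite big_nil.
rewrite big_cons; case Pi: (P i); last first.
  by apply: (expansion_eq (N := 0%N) _ IH) => m n _ _; rewrite big_cons Pi.
have := expansionM (h i) IH; rewrite !mul1r addrC.
by apply: (expansion_eq (N := 0%N)) => m n _ _; rewrite big_cons Pi.
Qed.

Lemma expansionX F b k : expansion F 1 b -> expansion (fun m n => F m n ^+ k) 1 (k%:R * b).
Proof.
move=> h; have := @expansion_prod 'I_k predT (fun=> F) (fun=> b) (fun=> h).
rewrite sumr_const card_ord mulr_natl.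
by apply: (expansion_eq (N := 0%N)) => m n _ _; rewrite prodr_const card_ord.
Qed.

Lemma expansion_affineV b : 0 <= b -> expansion (fun _ n => (1 + b / n%:R)^-1) 1 (- b).
Proof.
move=> b0; exists (b ^+ 2), 1%N => m n n0 _.
have n0' : 0 < n%:R :> R by rewrite ltr0n.
have d1 : 1 <= 1 + b / n%:R by rewrite lerDl divr_ge0.
have -> : (1 + b / n%:R)^-1 - (1 + - b / n%:R) = b ^+ 2 / n%:R ^+ 2 / (1 + b / n%:R).
  by field; rewrite ?gt_eqF // ltr_wpDr // ltW // lt_le_trans.
rewrite ger0_norm; last by rewrite !divr_ge0 ?exprn_ge0 ?(le_trans _ d1).
by rewrite ler_piMr ?divr_ge0 ?exprn_ge0 // invf_le1 // (lt_le_trans _ d1).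
Qed.

End Expansion.

(** * Two leading terms of power sums *)

Section PowerSum.
Context {R : realType}.

(** Summation by parts: in the double sum, [v ^ p] occurs [n + 1 - v] times. *)
Lemma powsum_succ n p :
  \sum_(x < n) (x.+1%:R : R) ^+ p.+1 =
  n.+1%:R * (\sum_(x < n) x.+1%:R ^+ p) - \sum_(y < n) \sum_(x < y.+1) x.+1%:R ^+ p.
Proof.
elim: n => [|n IH]; first by rewrite !big_ord0 mulr0 subr0.
rewrite !big_ord_recr /= IH exprS -[n.+2%:R]natr1; ring.
Qed.

(** Induction on the exponent through [powsum_succ], starting from exponent one, where the two terms
    are exact. *)
Lemma powsum_approx q : exists K : R, forall n : nat,
  `|\sum_(x < n) x.+1%:R ^+ q.+1 - (n%:R ^+ q.+2 / q.+2%:R + n%:R ^+ q.+1 / 2)|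
   <= K * n%:R ^+ q.
Proof.
elim: q => [|q [K h]].
  exists 0 => n; rewrite mul0r normr_le0 subr_eq0; apply/eqP.
  elim: n => [|n IH]; first by rewrite big_ord0 expr0n /= !mul0r addr0.
  by rewrite big_ord_recr /= IH -natr1; field.
have K0 : 0 <= K by have := h 1%N; rewrite !expr1n mulr1; apply: le_trans; exact: normr_ge0.
pose e (n : nat) : R := \sum_(x < n) x.+1%:R ^+ q.+1 - (n%:R ^+ q.+2 / q.+2%:R + n%:R ^+ q.+1 / 2).
exists (4 * K + 1) => n.
have T y : \sum_(x < y) x.+1%:R ^+ q.+1 = y%:R ^+ q.+2 / q.+2%:R + y%:R ^+ q.+1 / 2 + e y :> R.
  by rewrite /e addrC subrK.
have q2 : q.+2%:R != 0 :> R by rewrite pnatr_eq0.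
have q3 : q.+3%:R != 0 :> R by rewrite pnatr_eq0.
(* Summing the leading term over [y] reproduces the unknown sum, divided by [q + 2]. This is a
   linear equation for that sum, solved in [SE] below. *)
have eq1 : \sum_(x < n) x.+1%:R ^+ q.+2 =
    n.+1%:R * (n%:R ^+ q.+2 / q.+2%:R + n%:R ^+ q.+1 / 2 + e n)
    - ((\sum_(x < n) x.+1%:R ^+ q.+2) / q.+2%:R
       + (n%:R ^+ q.+2 / q.+2%:R + n%:R ^+ q.+1 / 2 + e n) / 2 + \sum_(y < n) e y.+1) :> R.
  rewrite {1}powsum_succ T; congr (_ - _).
  under eq_bigr => y _ do rewrite T.
  by rewrite !big_split /= -!mulr_suml -(T n).
pose x : R := n%:R.
have -> : \sum_(x < n) x.+1%:R ^+ q.+2 - (n%:R ^+ q.+3 / q.+3%:R + n%:R ^+ q.+2 / 2) =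
   q.+2%:R / q.+3%:R * (x ^+ q.+1 / 4 + (x + 2^-1) * e n - \sum_(y < n) e y.+1).
  move: eq1; rewrite -[n.+1%:R]natr1 -/x.
  move: (\sum_(y < n) e _) (\sum_(y < n) _) (e n) => V S en.
  have -> : x ^+ q.+3 = x * (x * x ^+ q.+1) by rewrite -!exprS.
  have -> : x ^+ q.+2 = x * x ^+ q.+1 by rewrite -!exprS.
  move: (x ^+ q.+1) => X.
  rewrite -[S / _ + _ + V]addrA; set B := _ + V; set A := (x + 1) * _ => eq1.
  have SE : S = (A - B) * q.+2%:R / q.+3%:R.
    apply: (canRL (mulfK q3)); rewrite -natr1 mulrDr mulr1.
    have : S * q.+2%:R = (A - (S / q.+2%:R + B)) * q.+2%:R by rewrite -eq1.
    by move=> ->; rewrite mulrBl mulrDl divfK //; ring.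
  rewrite SE /A /B -![q.+3%:R]natr1; field.
  have qq : 0 <= q%:R :> R by [].
  by apply/andP; split; apply: lt0r_neq0; lra.
have x0 : 0 <= x by [].
have eb : `|(x + 2^-1) * e n| <= 2 * K * x ^+ q.+1.
  have [n0|n0] := posnP n.
    by rewrite /e /x n0 big_ord0 !expr0n /= !mul0r addr0 subr0 !mulr0 normr0.
  have x1 : 1 <= x by rewrite ler1n.
  rewrite normrM ger0_norm; last lra.
  rewrite exprS [leRHS](_ : _ = 2 * x * (K * x ^+ q)); last by ring.
  apply: ler_pM => //; [lra|lra|exact: h].
have sb : `|\sum_(y < n) e y.+1| <= K * x ^+ q.+1.
  apply: le_trans (ler_norm_sum _ _ _) _.
  apply: (@le_trans _ _ (\sum_(y < n) K * x ^+ q)).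
    apply: ler_sum => y _; apply: le_trans (h _) _.
    by rewrite ler_wpM2l // lerXn2r ?nnegrE ?ler_nat.
  by rewrite sumr_const card_ord -[leLHS]mulr_natl exprS mulrCA.
have X0 : 0 <= x ^+ q.+1 by rewrite exprn_ge0.
rewrite normrM -[leRHS]mul1r; apply: ler_pM => //.
  by rewrite ger0_norm ?divr_ge0 // ler_pdivrMr ?ltr0n // mul1r ler_nat.
have KX : 0 <= K * x ^+ q.+1 by rewrite mulr_ge0.
move: eb sb; rewrite !ler_norml => /andP[? ?] /andP[? ?].
by apply/andP; split; lra.
Qed.

(** The weight is normalised to have limiting mean [1]. For [p = 0] the sum is exactly [1], so
    positivity of [p] matters for the second coefficient. *)
Lemma expansion_powsum (c : R) p : (0 < p)%N ->
  expansion c (fun _ n => \sum_(x < n) (p + 1)%:R * (x.+1%:R / n%:R) ^+ p / n%:R)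
    1 ((p + 1)%:R / 2).
Proof.
case: p => // q _; have [K h] := powsum_approx q.
exists (q.+2%:R * K), 1%N => m n n0 _.
have n0' : n%:R != 0 :> R by rewrite pnatr_eq0 -lt0n.
have q2 : q.+2%:R != 0 :> R by rewrite pnatr_eq0.
have n2 : 0 < n%:R ^+ q.+2 :> R by rewrite exprn_gt0 // ltr0n.
rewrite addn1.
have -> : \sum_(x < n) q.+2%:R * (x.+1%:R / n%:R) ^+ q.+1 / n%:R =
   q.+2%:R * (\sum_(x < n) x.+1%:R ^+ q.+1) / n%:R ^+ q.+2 :> R.
  rewrite mulr_sumr mulr_suml; apply: eq_bigr => x _.
  rewrite expr_div_n !exprS; field.
  by rewrite expf_neq0 // n0'.
have {h}h := h n; set S := \sum_(x < n) _ in h *.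
have -> : q.+2%:R * S / n%:R ^+ q.+2 - (1 + q.+2%:R / 2 / n%:R) =
   q.+2%:R / n%:R ^+ q.+2 * (S - (n%:R ^+ q.+2 / q.+2%:R + n%:R ^+ q.+1 / 2)).
  by rewrite !exprS; move: (q.+2%:R) q2 => z z0; field; rewrite z0 expf_neq0 // n0'.
rewrite normrM ger0_norm ?divr_ge0 ?exprn_ge0 //.
apply: le_trans (ler_wpM2l _ h) _; first by rewrite divr_ge0 ?exprn_ge0.
rewrite le_eqVlt; apply/orP; left; apply/eqP.
by rewrite !exprS expr0 mulr1; field; rewrite n0' expf_neq0.
Qed.

End PowerSum.

(** Out of range, [pref] returns [0] while the shifted entry would be [1]; [l <= m] keeps all marked
    cars in range. *)
Lemma unif_expect_PF (R : realType) m n l (p : 'I_l -> nat) : (l <= m)%N ->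
  unif_expect (PF m n) (fun pi => \prod_(i < l) (pref pi i)%:R ^+ p i) =
  seqsum n m (fun s => (\prod_(i < l) (nth 0%N s i).+1%:R ^+ p i) * parkind n s)
    / npark n m :> R.
Proof.
move=> lm; rewrite /unif_expect -sum1_card natr_sum /npark.
rewrite -!seqsum_tuple !big_mkcond; congr (_ / _).
  apply: eq_bigr => pi _; rewrite mem_PF /parkind.
  case: ifP => _; last by rewrite mulr0.
  rewrite mulr1; apply: eq_bigr => i _; congr (_%:R ^+ _).
  rewrite /pref -(nth_map 0%N 0%N) ?size_map ?size_tuple -?map_comp //.
  exact: leq_trans lm.
by rewrite big_mkcond; apply: eq_bigr => pi _; rewrite mem_PF /parkind; case: ifP.
Qed.

(** * Asymptotics along [m = c n] *)

Section Regime.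
Context {R : realType} (c : R) (l : nat).
Hypotheses (c0 : 0 < c) (c1 : c < 1).
Implicit Types m n : nat.

Lemma regime_large : exists N, forall m n, (N <= n)%N -> m%:R = c * n%:R ->
  [/\ (0 < n)%N, (l <= m)%N & (m <= n)%N].
Proof.
exists (Num.bound (l%:R / c)).+1 => m n Nn mn; split; first by lia.
  rewrite -(ler_nat R) mn mulrC -ler_pdivrMr //.
  have lc0 : 0 <= l%:R / c by rewrite divr_ge0 // ltW.
  by apply: ltW (lt_le_trans (archi_boundP lc0) _); rewrite ler_nat ltnW.
by rewrite -(ler_nat R) mn ler_piMl // ltW.
Qed.

(** This is [nparkE] with [n + 1 - (m - k) = (1 - c) * n + k + 1], factored so that the expansion
    rules apply. *)
Lemma npark_regime m n k : m%:R = c * n%:R -> (0 < n)%N -> (k <= m)%N -> (m <= n)%N ->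
  npark n (m - k) =
  n%:R * (1 - c) * (1 + (k.+1%:R / (1 - c)) / n%:R) * n.+1%:R ^+ (m - k) / n.+1%:R.
Proof.
move=> mn n0 km mn'.
have n1 : n.+1%:R != 0 :> R by rewrite pnatr_eq0.
have n0' : n%:R != 0 :> R by rewrite pnatr_eq0 -lt0n.
have c1' : 1 - c != 0 by rewrite gt_eqF // subr_gt0.
apply: (mulfI n1); rewrite nparkE; last by lia.
rewrite natrB ?natrB //; last by lia.
rewrite mn -!natr1; field; by rewrite n0' c1' natr1 n1.
Qed.

Lemma npark_gt0 m n k : m%:R = c * n%:R -> (0 < n)%N -> (k <= m)%N -> (m <= n)%N ->
  0 < npark n (m - k) :> R.
Proof.
move=> mn n0 km mn'; rewrite (npark_regime mn) //.
have n0' : 0 < n%:R :> R by rewrite ltr0n.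
have c10 : 0 < 1 - c by rewrite subr_gt0.
by rewrite !mulr_gt0 ?invr_gt0 ?exprn_gt0 ?ltr0n // addr_gt0 // !mulr_gt0 ?invr_gt0.
Qed.

Hypothesis l0 : (0 < l)%N.

(** By [sum_spill] the quantity is one minus a ratio of consecutive counts, and its first
    coefficient is [(l + 1) / (1 - c) - l / (1 - c) - 1 = c / (1 - c)]. *)
Lemma expansion_spill_mass :
  expansion c (fun m n => (\sum_(x < n) spill n (m - l) x) / (npark n (m - l) * n%:R))
    0 (c / (1 - c)).
Proof.
have c10 : 0 < 1 - c by rewrite subr_gt0.
have b0 : 0 <= l.+1%:R / (1 - c) by rewrite divr_ge0 // ltW.
have := expansionD (expansion_cst c 1) (expansionZ (-1) (expansionM (expansionM
  (expansion_affine c 1 (l%:R / (1 - c))) (expansion_affine c 1 1)) (expansion_affineV c b0))).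
rewrite !mulr1 subrr add0r (_ : -1 * _ = c / (1 - c)); last first.
  by rewrite -natr1; field; rewrite gt_eqF.
have [N hN] := regime_large.
apply: (expansion_eq (N := N)) => m n Nn mn; have [n0 lm mn'] := hN m n Nn mn.
have A0 := npark_gt0 mn n0 lm mn'.
rewrite sum_spill mulrBl [n%:R * _]mulrC divff ?mulf_neq0 ?gt_eqF ?ltr0n //.
rewrite mulN1r; congr (_ - _).
have lE : (l.-1.+1 = l)%N by rewrite prednK.
(* Adding one car to [m - l] gives [m - (l - 1)], which requires [l] to be positive. *)
have mE : ((m - l).+1 = m - l.-1)%N by lia.
rewrite mE (npark_regime (k := l.-1) mn) //; last by lia.
rewrite lE -mE (npark_regime mn) // exprS.
have n0' : 0 < n%:R :> R by rewrite ltr0n.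
have E0 : n.+1%:R ^+ (m - l) != 0 :> R by rewrite expf_neq0 ?pnatr_eq0.
have b2 : 0 < (1 - c) * n%:R + l.+1%:R by rewrite ltr_wpDr // mulr_gt0.
have b1 : 0 < n.+1%:R :> R by rewrite ltr0n.
move: E0 b2 b1; rewrite -!natr1.
move: (_ ^+ (m - l)) => E E0 b2 b1; field.
by rewrite E0 !gt_eqF.
Qed.

Lemma expansion_npark_ratio :
  expansion c (fun m n => npark n (m - l) * n%:R ^+ l / npark n m)
    1 (l%:R * (c / (1 - c))).
Proof.
have c10 : 0 < 1 - c by rewrite subr_gt0.
have b3 : 0 <= 1 / (1 - c) by rewrite divr_ge0 // ltW.
have := expansionM (expansionM (expansion_affine c 1 (l.+1%:R / (1 - c)))
  (expansion_affineV c b3)) (expansionX l (expansion_affineV c (@ler01 R))).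
rewrite !mulr1 (_ : 1 * (l%:R * -1) + 1 * _ = l%:R * (c / (1 - c))); last first.
  by rewrite -natr1; field; rewrite gt_eqF.
have [N hN] := regime_large.
apply: (expansion_eq (N := N)) => m n Nn mn; have [n0 lm mn'] := hN m n Nn mn.
have n0' : 0 < n%:R :> R by rewrite ltr0n.
have b1 : 0 < n.+1%:R :> R by rewrite ltr0n.
have -> : (1 + 1 / n%:R)^-1 = n%:R / n.+1%:R :> R.
  by rewrite -natr1; field; rewrite natr1 !gt_eqF.
have -> : npark n m = npark n (m - 0) :> R by rewrite subn0.
rewrite !(npark_regime mn) // subn0.
have -> : n.+1%:R ^+ m = n.+1%:R ^+ (m - l) * n.+1%:R ^+ l :> R.
  by rewrite -exprD subnK.
rewrite expr_div_n.
have b2 : 0 < (1 - c) * n%:R + 1 by rewrite addr_gt0 // mulr_gt0.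
have E0 : n.+1%:R ^+ (m - l) != 0 :> R by rewrite expf_neq0 ?gt_eqF.
have L0 : n.+1%:R ^+ l != 0 :> R by rewrite expf_neq0 ?gt_eqF.
move: E0 L0 b1; move: (n.+1%:R : R) (n.+1%:R ^+ l : R) (_ ^+ (m - l)) => z L E E0 L0 b1; field.
by rewrite E0 L0 !gt_eqF.
Qed.

(** The inverse of the preceding ratio, expanded from the same closed forms; it enters the total of
    [overlap]. *)
Lemma expansion_npark_ratioV :
  expansion c (fun m n => npark n m / (npark n (m - l) * n%:R ^+ l))
    1 (- (l%:R * (c / (1 - c)))).
Proof.
have c10 : 0 < 1 - c by rewrite subr_gt0.
have b2 : 0 <= l.+1%:R / (1 - c) by rewrite divr_ge0 // ltW.
have := expansionM (expansionM (expansion_affine c 1 (1 / (1 - c)))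
  (expansion_affineV c b2)) (expansionX l (expansion_affine c 1 1)).
rewrite !mulr1 (_ : 1 * (l%:R) + 1 * _ = - (l%:R * (c / (1 - c)))); last first.
  by rewrite -natr1; field; rewrite gt_eqF.
have [N hN] := regime_large.
apply: (expansion_eq (N := N)) => m n Nn mn; have [n0 lm mn'] := hN m n Nn mn.
have n0' : 0 < n%:R :> R by rewrite ltr0n.
have b1 : 0 < n.+1%:R :> R by rewrite ltr0n.
have -> : 1 + 1 / n%:R = n.+1%:R / n%:R :> R.
  by rewrite -natr1; field; rewrite gt_eqF.
have -> : npark n m = npark n (m - 0) :> R by rewrite subn0.
rewrite !(npark_regime mn) // subn0.
have -> : n.+1%:R ^+ m = n.+1%:R ^+ (m - l) * n.+1%:R ^+ l :> R.
  by rewrite -exprD subnK.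
rewrite expr_div_n.
have b3 : 0 < (1 - c) * n%:R + l.+1%:R by rewrite addr_gt0 // mulr_gt0.
have E0 : n.+1%:R ^+ (m - l) != 0 :> R by rewrite expf_neq0 ?gt_eqF.
have L0 : n%:R ^+ l != 0 :> R by rewrite expf_neq0 ?gt_eqF.
move: E0 L0 b1 b3; move: (l.+1%:R : R) (n.+1%:R : R) (n%:R ^+ l : R) (n.+1%:R ^+ l : R) (_ ^+ (m - l))
  => l1 z L L' E E0 L0 b1 b3; field.
by rewrite E0 L0 !gt_eqF.
Qed.

Lemma spill_moment_regime : exists2 K : R, 0 <= K &
  exists N, forall m n, (N <= n)%N -> m%:R = c * n%:R ->
    (\sum_(x < n) (n - x)%:R * spill n (m - l) x) / npark n (m - l) <= K.
Proof.
have r1 := chernoff_lt1 c0 c1.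
exists (2 / ((1 - c) * (1 - chernoff c) ^+ 3)).
  by rewrite divr_ge0 // mulr_ge0 ?exprn_ge0 // subr_ge0 ltW.
have [N hN] := regime_large; exists N => m n Nn mn; have [n0 lm mn'] := hN m n Nn mn.
rewrite ler_pdivrMr ?(npark_gt0 mn) //; apply: spill_moment => //.
by rewrite -mn ler_nat leq_subr.
Qed.

Lemma subr_exp_le p (u : R) : 0 <= u -> u <= 1 -> 1 - u ^+ p <= p%:R * (1 - u).
Proof.
move=> u0 u1; elim: p => [|p IH]; first by rewrite subrr mul0r.
have -> : 1 - u ^+ p.+1 = (1 - u) + u * (1 - u ^+ p) by rewrite exprS; ring.
rewrite -natr1 mulrDl mul1r addrC lerD2r; apply: le_trans IH.
by rewrite ler_piMl // subr_ge0 exprn_ile1.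
Qed.

(** Since [spill] lives near [x = n], its weight is nearly [p + 1]: the error is at most
    [(p + 1) * p * (n - x) / n], so the bounded first moment makes it [O(1 / n ^ 2)] after
    normalisation. *)
Lemma expansion_weighted_spill p :
  expansion c (fun m n => (\sum_(x < n)
      (p + 1)%:R * (x.+1%:R / n%:R) ^+ p * spill n (m - l) x)
        / (npark n (m - l) * n%:R))
    0 ((p + 1)%:R * (c / (1 - c))).
Proof.
have [K K0 [N1 hK]] := spill_moment_regime; have [N2 hN] := regime_large.
have := expansionZ (p + 1)%:R expansion_spill_mass; rewrite mulr0.
apply: (expansion_close (K := (p + 1)%:R * p%:R * K) (N := maxn N1 N2)) => m n.
rewrite geq_max => /andP[/hK h /hN h2] mn; have [n0 lm mn'] := h2 m mn.
have A0 : 0 < npark n (m - l) :> R by rewrite (npark_gt0 mn).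
have n0' : 0 < n%:R :> R by rewrite ltr0n.
have := h m mn; rewrite ler_pdivrMr //; set A := npark n _; set Q := \sum_(x < n) _ => hQ.
have u1 (x : 'I_n) : x.+1%:R / n%:R <= 1 :> R by rewrite ler_pdivrMr // mul1r ler_nat.
have u0 (x : 'I_n) : 0 <= x.+1%:R / n%:R :> R by rewrite divr_ge0.
set S := \sum_(x < n) _ * _; set T := \sum_(x < n) spill _ _ _.
have dE : (p + 1)%:R * T - S = \sum_(x < n)
    (p + 1)%:R * (1 - (x.+1%:R / n%:R) ^+ p) * spill n (m - l) x.
  by rewrite mulr_sumr -sumrB; apply: eq_bigr => x _; ring.
have d0 : 0 <= (p + 1)%:R * T - S.
  rewrite dE sumr_ge0 // => x _; rewrite !mulr_ge0 ?spill_ge0 //.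
  by rewrite subr_ge0 exprn_ile1.
have dQ : (p + 1)%:R * T - S <= (p + 1)%:R * p%:R / n%:R * Q.
  rewrite dE mulr_sumr; apply: ler_sum => x _; rewrite [leRHS]mulrA.
  rewrite ler_wpM2r ?spill_ge0 // -!mulrA ler_wpM2l //.
  apply: le_trans (subr_exp_le _ (u0 x) (u1 x)) _; rewrite ler_wpM2l //.
  rewrite ler_pdivlMl // mulrBr mulr1 mulrCA divff ?gt_eqF // mulr1.
  by rewrite natrB ?(ltnW (ltn_ord x)) // lerD2l lerN2 ler_nat.
rewrite distrC mulrA -mulrBl ger0_norm; last by rewrite divr_ge0 // mulr_ge0 // ltW.
rewrite ler_pdivrMr ?mulr_gt0 //; apply: le_trans dQ _.
rewrite [leRHS](_ : _ = (p + 1)%:R * p%:R / n%:R * (K * A)).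
  by rewrite ler_wpM2l // divr_ge0 ?mulr_ge0.
by field; rewrite gt_eqF.
Qed.

(** With all weights equal to [1], [seqsum_weighted_parkind] expresses the total of [overlap]
    through known quantities, whose coefficients cancel up to order [1 / n]. *)
Lemma expansion_overlap_mass :
  expansion c (fun m n => seqsum n l (overlap n (m - l)) / (npark n (m - l) * n%:R ^+ l)) 0 0.
Proof.
have [N hN] := regime_large.
have := expansionD (expansionD (expansion_cst c 1) (expansionZ (- l%:R) expansion_spill_mass))
  (expansionZ (-1) expansion_npark_ratioV).
rewrite mulr0 addr0 mulr1 subrr (_ : 0 + _ + _ = 0); last by ring.
apply: (expansion_eq (N := N)) => m n Nn mn; have [n0 lm mn'] := hN m n Nn mn.
have n0' : n%:R != 0 :> R by rewrite pnatr_eq0 -lt0n.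
have A0 : npark n (m - l) != 0 :> R by rewrite gt_eqF ?(npark_gt0 mn).
have := seqsum_weighted_parkind n (m - l) (fun (_ : 'I_l) _ => (1 : R)).
rewrite subnKC // (@eq_seqsum _ n m _ (parkind n)); last first.
  by move=> s _ _; rewrite big1 // mul1r.
rewrite (@eq_seqsum _ n l _ (overlap n (m - l))); last first.
  by move=> s _ _; rewrite big1 // mul1r.
rewrite -/(npark n m) sumr_const card_ord prodr_const card_ord.
under eq_bigr => i _.
  rewrite (_ : \prod_(k | k != i) _ = n%:R ^+ l / n%:R); last first.
    apply: (canRL (mulfK n0')); rewrite mulrC -[in RHS](card_ord l) -prodr_const.
    by rewrite [RHS](bigD1 i).
  under eq_bigr => x _ do rewrite mul1r.
  over.
rewrite sumr_const card_ord -[_ *+ l]mulr_natl.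
set T := \sum_(x < n) _; set V := seqsum _ _ _; set A := npark n (m - l) in A0 * => hZ.
have -> : V = A * n%:R ^+ l - l%:R * (T * (n%:R ^+ l / n%:R)) - npark n m.
  by rewrite hZ; ring.
by field; rewrite expf_neq0 // A0 n0'.
Qed.

(** A signed total is not enough under varying weights. The weights are bounded by [B], so the
    estimate passes through the l1-norm and [overlap_norm]. *)
Lemma expansion_weighted_overlap (p : 'I_l -> nat) :
  expansion c (fun m n => seqsum n l (fun j =>
      (\prod_(i < l) ((p i + 1)%:R * ((nth 0%N j i).+1%:R / n%:R) ^+ p i))
        * overlap n (m - l) j) / (npark n (m - l) * n%:R ^+ l)) 0 0.
Proof.
have [K K0 [N1 hK]] := spill_moment_regime; have [N2 hN] := regime_large.
have [K' [N3 hK']] := expansion_overlap_mass.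
pose B : R := \prod_(i < l) (p i + 1)%:R.
have B0 : 0 <= B by apply: prodr_ge0.
exists (B * (K' + 4 * l%:R ^+ 2 * K)), (maxn N1 (maxn N2 N3)) => m n.
rewrite !geq_max => /and3P[N1n N2n N3n] mn; have [n0 lm mn'] := hN m n N2n mn.
have A0 : 0 < npark n (m - l) :> R by rewrite (npark_gt0 mn).
have n0' : 0 < n%:R :> R by rewrite ltr0n.
set W := seqsum n l _; have := overlap_norm (R := R) (m - l) l n0.
have nl0 : 0 < n%:R ^+ l :> R by rewrite exprn_gt0.
have := hK m n N1n mn; have := hK' m n N3n mn; rewrite mul0r addr0 subr0.
set A := npark n _ in A0 *; set Q := \sum_(x < n) _; set V := seqsum n l (overlap _ _).
move=> hV; rewrite ler_pdivrMr // => hQ hW.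
have Anl : 0 < A * n%:R ^+ l by rewrite mulr_gt0.
rewrite subr0 normrM [X in _ * X]ger0_norm ?invr_ge0 ?(ltW Anl) //.
have WB : `|W| <= B * seqsum n l (fun j => `|overlap n (m - l) j|).
  apply: le_trans (ler_norm_seqsum _ _ _) _; rewrite -seqsumZ.
  apply: ler_seqsum => j jl /allP jn; rewrite normrM ler_wpM2r //.
  rewrite normr_prod; apply: ler_prod => i _; rewrite normr_ge0 /=.
  rewrite ger0_norm ?mulr_ge0 ?exprn_ge0 ?divr_ge0 //.
  rewrite ler_piMr ?exprn_ile1 ?divr_ge0 // ler_pdivrMr // mul1r ler_nat.
  by apply: jn; rewrite mem_nth ?jl.
have V2 : n%:R ^+ 2 * V <= K' * (A * n%:R ^+ l).
  rewrite mulrC -ler_pdivlMr ?exprn_gt0 // mulrAC -ler_pdivrMr //.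
  exact: le_trans (ler_norm _) hV.
have Q2 : 4 * l%:R ^+ 2 * n%:R ^+ l * Q <= 4 * l%:R ^+ 2 * n%:R ^+ l * (K * A).
  by rewrite ler_wpM2l // !mulr_ge0 ?exprn_ge0.
rewrite ler_pdivrMr ?mulr_gt0 // mulrAC ler_pdivlMr ?exprn_gt0 //.
rewrite mulrC; apply: le_trans (ler_wpM2l (exprn_ge0 _ (ltW n0')) WB) _.
rewrite mulrCA -[leRHS]mulrA ler_wpM2l //.
apply: le_trans hW _; apply: le_trans (lerD V2 Q2) _.
by rewrite le_eqVlt; apply/orP; left; apply/eqP; ring.
Qed.

End Regime.

(** * Assembly of the moment expansion *)

Theorem theorem3p3 (R : realType) (l : nat) (p : 'I_l -> nat) (c : R)
    (hl : (1 <= l)%N) (hp : forall i, (1 <= p i)%N) (hc0 : 0 < c) (hc1 : c < 1) :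
  exists (K : R) (N : nat), forall m n : nat, (N <= n)%N -> m%:R = c * n%:R ->
    exists2 r : R, `|r| <= K / n%:R ^+ 2 &
      unif_expect (PF m n) (fun pi => \prod_(i < l) (pref pi i)%:R ^+ p i) =
        n%:R ^+ (\sum_(i < l) p i) / \prod_(i < l) (p i + 1)%:R *
        (1 + n%:R^-1 * ((\sum_(i < l) p i + l)%:R / 2
                        - c * (\sum_(i < l) p i)%:R / (1 - c)) + r).
Proof.
have c10 : 1 - c != 0 by rewrite gt_eqF // subr_gt0.
(* Normalised weights: their averages tend to [1], and the prefactor of the statement is split
   off. *)
pose g i n x : R := (p i + 1)%:R * (x.+1%:R / n%:R) ^+ p i.
pose a i (m n : nat) : R := \sum_(x < n) g i n x / n%:R.
have ea i : expansion c (a i) 1 ((p i + 1)%:R / 2) by apply: expansion_powsum.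
pose t i (m n : nat) : R :=
  (\sum_(x < n) g i n x * spill n (m - l) x) / (npark n (m - l) * n%:R).
have et i : expansion c (t i) 0 ((p i + 1)%:R * (c / (1 - c))).
  exact: expansion_weighted_spill.
have eo := expansion_weighted_overlap hc0 hc1 hl p.
have er := expansion_npark_ratio l hc0 hc1.
(* The ratio of counts multiplies the product of averages minus the single-failure terms minus the
   [overlap] term, each divided by [npark n (m - l) * n ^ l]. *)
have := expansionM er (expansionD (expansionD (expansion_prod predT ea)
  (expansionZ (-1) (expansion_sum (fun i => expansionM (et i)
     (expansion_prod (predC1 i) ea))))) (expansionZ (-1) eo)).
set b := (X in expansion c _ _ X); set b1 := (X in expansion c _ X _).
set F := (X in expansion c X _ _).
have b1E : b1 = 1.
  by rewrite /b1 big1 => [|i _]; rewrite ?mul0r // !mulr0 !addr0 mulr1.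
(* The power sums give the first fraction. The ratio of counts adds [l * c / (1 - c)] and the single
   failures subtract [(p i + 1) * c / (1 - c)] for each [i], so the terms in [l] cancel. *)
have bE : b = (\sum_(i < l) p i + l)%:R / 2 - c * (\sum_(i < l) p i)%:R / (1 - c).
  rewrite /b; under [X in -1 * X]eq_bigr => i _ do rewrite mul0r add0r mul1r.
  rewrite [in X in _ + X * _]big1 => [|i _]; last by rewrite mul0r.
  rewrite -!mulr_suml.
  have -> : \sum_(i < l) (p i + 1)%:R = (\sum_(i < l) p i + l)%:R :> R.
    by rewrite -natr_sum big_split /= sum1_card card_ord.
  by rewrite natrD; field.
rewrite b1E bE => -[K [N hK]].
have [N' hN] := regime_large l hc0 hc1.
exists K, (maxn N N') => m n; rewrite geq_max => /andP[Nn N'n] mn.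
have [n0 lm mn'] := hN m n N'n mn.
have n0' : n%:R != 0 :> R by rewrite pnatr_eq0 -lt0n.
have A0 : npark n (m - l) != 0 :> R by rewrite gt_eqF // (npark_gt0 hc0 hc1 mn).
have Z0 : npark n m != 0 :> R by rewrite gt_eqF // -[m]subn0 (npark_gt0 hc0 hc1 mn).
have nl0 : n%:R ^+ l != 0 :> R by rewrite expf_neq0.
exists (F m n - (1 + ((\sum_(i < l) p i + l)%:R / 2
    - c * (\sum_(i < l) p i)%:R / (1 - c)) / n%:R)); first exact: hK.
rewrite [n%:R^-1 * _]mulrC addrC subrK unif_expect_PF //.
set D := \prod_(i < l) (p i + 1)%:R.
have D0 : D != 0 by apply/prodf_neq0 => i _; rewrite pnatr_eq0 addn1.
set P := n%:R ^+ _.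
have P0 : P != 0 by rewrite expf_neq0.
(* Restores the scale: passing to the weights [g] divides by [P / D]. *)
have -> : seqsum n m (fun s => (\prod_(i < l) (nth 0%N s i).+1%:R ^+ p i) * parkind n s)
  = P / D * seqsum n m (fun s => (\prod_(i < l) g i n (nth 0%N s i)) * parkind n s).
  rewrite -seqsumZ; apply: eq_seqsum => s _ _; rewrite mulrA; congr (_ * _).
  rewrite /g big_split /= -/D mulrA divfK // /P -prodrXr -big_split /=.
  by apply: eq_bigr => i _; rewrite expr_div_n mulrC divfK // expf_neq0.
rewrite -[LHS]mulrA; congr (_ * _).
have := seqsum_weighted_parkind n (m - l) (fun i x => g i n x).
rewrite subnKC // => ->.
have aE i : \sum_(x < n) g i n x = n%:R * a i m n.
  by rewrite /a -mulr_suml mulrC divfK.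
have tE i : \sum_(x < n) g i n x * spill n (m - l) x = npark n (m - l) * n%:R * t i m n.
  by rewrite /t mulrC divfK // mulf_neq0.
have -> : \prod_(i < l) \sum_(x < n) g i n x = n%:R ^+ l * \prod_(i < l) a i m n.
  by under eq_bigr do rewrite aE; rewrite big_split /= prodr_const card_ord.
have -> : \sum_(i < l) (\sum_(x < n) g i n x * spill n (m - l) x)
      * (\prod_(k < l | k != i) \sum_(x < n) g k n x)
    = npark n (m - l) * n%:R ^+ l * \sum_(i < l) (t i m n * \prod_(k | k != i) a k m n).
  rewrite mulr_sumr; apply: eq_bigr => i _; rewrite tE.
  rewrite (eq_bigr (fun k => n%:R * a k m n)) => [|k _]; last exact: aE.
  rewrite big_split /=.
  have -> : n%:R ^+ l = n%:R * \prod_(k < l | k != i) n%:R :> R.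
    by rewrite -[in LHS](card_ord l) -prodr_const [LHS](bigD1 i).
  ring.
set U := seqsum n l _.
by rewrite /F -/U; field; rewrite nl0 A0 Z0.
Qed.
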